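(* For all integers $n\geq 0$, $$a_{1^{-1}2^{2}5^{-1}}(5n)>0,\quad a_{1^{-1}2^{2}5^{-1}}(5n+1)>0,\quad a_{1^{-1}2^{2}5^{-1}}(5n+2)=0,$$ $$a_{1^{-1}2^{2}5^{-1}}(5n+3)>0,\quad a_{1^{-1}2^{2}5^{-1}}(5n+4)=0.$$
   Context: For $|q|<1$ (or as formal power series in $q$) let $f_j:=(q^j;q^j)_\infty=\prod_{k\ge 1}(1-q^{jk})$ for each positive integer $j$. The integers $a_{1^{-1}2^{2}5^{-1}}(n)$, $n\ge 0$, are defined by $\sum_{n=0}^\infty a_{1^{-1}2^{2}5^{-1}}(n)q^n=\dfrac{f_2^2}{f_1f_5}$. *)

(* Defs.v *)
From HB Require Import structures.
From mathcomp Require Import all_boot all_order all_algebra.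

Set Implicit Arguments.
Unset Strict Implicit.
Unset Printing Implicit Defensive.

Import GRing.Theory.
Local Open Scope ring_scope.

(* A formal power series is represented by its sequence of coefficients
   [u : nat -> R], standing for [\sum_n u n * q ^ n]. *)

Definition fps_one {R : comUnitRingType} : nat -> R := fun n => (n == 0%N)%:R.

Definition fps_mul {R : comUnitRingType} (u v : nat -> R) : nat -> R :=
  fun n => \sum_(i < n.+1) u i * v (n - i)%N.

(* [fps_inv_seq u n] lists the coefficients 0, ..., n of the inverse series,
   obtained by solving [u * v = 1] for one coefficient of [v] at a time. *)
Fixpoint fps_inv_seq {R : comUnitRingType} (u : nat -> R) (n : nat) : seq R :=
  if n is m.+1 then
    let s := fps_inv_seq u m in
    rcons s (- ((u 0%N)^-1 * \sum_(i < m.+1) u (m.+1 - i)%N * s`_i))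
  else [:: (u 0%N)^-1].

(* Meaningful only when [u 0] is a unit; see [fps_mulV]. *)
Definition fps_inv {R : comUnitRingType} (u : nat -> R) : nat -> R :=
  fun n => (fps_inv_seq u n)`_n.

Definition fps_div {R : comUnitRingType} (u v : nat -> R) : nat -> R :=
  fps_mul u (fps_inv v).

(* [\prod_(1 <= k <= N) (1 - q ^ (j k))] *)
Definition qprod (j N : nat) : {poly int} :=
  \prod_(1 <= k < N.+1) (1 - 'X^(j * k)).

(* The infinite product [(q^j; q^j)_oo]: for [0 < j], the factors with
   [k > n] do not affect the coefficient of [q ^ n]; see [euler_f_stable]. *)
Definition euler_f (j : nat) : nat -> int := fun n => (qprod j n)`_n.

(* [f_1^(-1) f_2^2 f_5^(-1)]; see [eta_denominator_unit]. *)
Definition a_1m1_2p2_5m1 : nat -> int :=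
  fps_div (fps_mul (euler_f 2) (euler_f 2)) (fps_mul (euler_f 1) (euler_f 5)).

Lemma euler_f_stable (j n N : nat) :
  (0 < j)%N -> (n <= N)%N -> (qprod j N)`_n = euler_f j n.
Proof.
move=> j0; elim: N => [|N IH]; first by rewrite leqn0 => /eqP ->.
rewrite leq_eqVlt => /predU1P[-> //|nN].
rewrite /qprod big_nat_recr //= -/(qprod j N) mulrBr mulr1 coefB coefMXn.
have -> : (n < j * N.+1)%N by apply: leq_trans nN _; rewrite leq_pmull.
by rewrite subr0 IH.
Qed.

Lemma size_fps_inv_seq (R : comUnitRingType) (u : nat -> R) n :
  size (fps_inv_seq u n) = n.+1.
Proof. by elim: n => //= n IH; rewrite size_rcons IH. Qed.

Lemma nth_fps_inv_seq (R : comUnitRingType) (u : nat -> R) n i :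
  (i <= n)%N -> (fps_inv_seq u n)`_i = fps_inv u i.
Proof.
elim: n => [|n IH]; first by rewrite leqn0 => /eqP ->.
rewrite leq_eqVlt => /predU1P[-> //|lin] /=.
by rewrite nth_rcons size_fps_inv_seq lin IH.
Qed.

Lemma fps_mulV (R : comUnitRingType) (u : nat -> R) :
  u 0%N \is a GRing.unit -> fps_mul u (fps_inv u) =1 fps_one.
Proof.
move=> u0 [|n]; rewrite /fps_mul /fps_one.
  by rewrite big_ord1 /fps_inv /= divrr.
rewrite big_ord_recl /= subn0 {1}/fps_inv /= nth_rcons size_fps_inv_seq ltnn eqxx.
rewrite mulrN mulrA divrr // mul1r [X in - X + _](reindex_inj rev_ord_inj) /=.
apply/eqP; rewrite addrC subr_eq0; apply/eqP; apply: eq_bigr => i _.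
have lin := ltn_ord i.
rewrite nth_fps_inv_seq; last by rewrite subSS leq_subr.
by rewrite !subSS subSn ?leq_subr // subKn // /bump leq0n.
Qed.

Lemma euler_f0 j : euler_f j 0 = 1.
Proof. by rewrite /euler_f /qprod big_geq // coef1. Qed.

Lemma eta_denominator_unit :
  fps_mul (euler_f 1) (euler_f 5) 0%N \is a GRing.unit.
Proof. by rewrite /fps_mul big_ord1 !euler_f0 // mulr1 unitr1. Qed.

(* Main.v *)
(** Gauss's identity [f_2 ^ 2 / f_1 = \sum_s q ^ (s (s + 1) / 2)] turns the
    generating function into [\sum_s q ^ (s (s + 1) / 2) / f_5].  Triangular
    numbers are 0, 1 or 3 modulo 5, all three classes occur among 0, 1, 3, and
    [1 / f_5] has positive coefficients exactly at the multiples of 5.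
    Gauss's identity is obtained from Shanks's finite version, which is exact
    for polynomials and is proved by telescoping. *)

Require Import Defs.
From mathcomp Require Import all_boot all_order all_algebra.
From mathcomp Require Import ring zify.
From Corelib Require Import Setoid Morphisms.

Import Order.TTheory GRing.Theory Num.Theory.
Local Open Scope ring_scope.

(** Congruence modulo ['X^N]. The instances below allow truncated series to be replaced inside
    products by [rewrite]. *)
Definition eqmodX {R : nzRingType} (N : nat) (p q : {poly R}) : Prop :=
  forall i, (i < N)%N -> p`_i = q`_i.

#[export] Instance eqmodX_equiv {R : nzRingType} N : Equivalence (@eqmodX R N).
Proof.
split=> [p i // | p q pq i iN | p q r pq qr i iN]; first by rewrite pq.
by rewrite pq // qr.
Qed.

#[export] Instance eqmodX_mul {R : nzRingType} N :
  Proper (@eqmodX R N ==> @eqmodX R N ==> @eqmodX R N) *%R.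
Proof.
move=> p p' pp' q q' qq' i iN; rewrite !coefM; apply: eq_bigr => j _.
by rewrite pp' ?qq' //; have := ltn_ord j; lia.
Qed.

Lemma eqmodX_addMXn {R : nzRingType} N M (p q : {poly R}) :
  (N <= M)%N -> eqmodX N (p + q * 'X^M) p.
Proof.
move=> NM i iN; rewrite coefD coefMXn.
by rewrite (leq_trans iN NM) addr0.
Qed.

Lemma fps_mul_eqmodX {R : comUnitRingType} N (u v : nat -> R) :
  eqmodX N (\poly_(i < N) fps_mul u v i)
           ((\poly_(i < N) u i) * \poly_(i < N) v i).
Proof.
move=> i iN; rewrite coef_poly iN coefM; apply: eq_bigr => j _.
by rewrite !coef_poly (leq_ltn_trans (leq_subr _ _) iN) ifT //;
  have := ltn_ord j; lia.
Qed.

Lemma euler_f_eqmodX j n N :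
  (0 < j)%N -> (n <= N)%N ->
  eqmodX n.+1 (\poly_(i < n.+1) euler_f j i) (qprod j N).
Proof.
move=> j0 nN i lt_in; rewrite coef_poly lt_in euler_f_stable //.
exact: leq_trans nN.
Qed.

Definition odd_qprod (n : nat) : {poly int} := \prod_(k < n) (1 - 'X^(2 * k + 1)).

(** Summand of Shanks's identity after clearing denominators: the first product is the quotient of
    [qprod 2 n] by [qprod 2 s] when [s <= n]. *)
Definition shanks_term (n s : nat) : {poly int} :=
  (\prod_(s.+1 <= k < n.+1) (1 - 'X^(2 * k))) * odd_qprod s * 'X^(s * (2 * n + 1)).

Definition tri_poly (n : nat) : {poly int} := \sum_(s < n) 'X^('C(s.+1, 2)).

Lemma odd_qprodS n : odd_qprod n.+1 = odd_qprod n * (1 - 'X^(2 * n + 1)).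
Proof. by rewrite /odd_qprod big_ord_recr. Qed.

(* Telescopes with the antidifference
   [\prod_(s <= k < n.+1) (1 - 'X^(2 * k)) * odd_qprod s * 'X^(s * (2 * n + 1))],
   which vanishes at [s = 0] because of its factor [k = 0]. *)
Lemma shanks_telescope n m : (m <= n.+1)%N ->
  \sum_(s < m) (shanks_term n.+1 s - (1 - 'X^(2 * n + 1)) * shanks_term n s) =
  (\prod_(m <= k < n.+1) (1 - 'X^(2 * k))) * odd_qprod m * 'X^(m * (2 * n + 1)).
Proof.
elim: m => [|m IH] lt_mn.
  by rewrite big_ord0 big_ltn // muln0 expr0 subrr !mul0r.
rewrite big_ord_recr /= IH; last exact: ltnW.
rewrite /shanks_term odd_qprodS (big_ltn lt_mn).
rewrite (big_nat_recr n.+1 m.+1) //=.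
have -> : (m * (2 * n.+1 + 1) = m * (2 * n + 1) + 2 * m)%N by lia.
have -> : (m.+1 * (2 * n + 1) = m * (2 * n + 1) + (2 * n + 1))%N by lia.
have -> : (2 * n.+1 = (2 * n + 1) + 1)%N by lia.
move: (2 * n + 1)%N (2 * m)%N (m * _)%N => c d e.
rewrite !exprD expr1.
by ring.
Qed.

Lemma bin2_even n : 'C((2 * n).+1, 2) = (n * (2 * n + 1))%N.
Proof. by rewrite bin2 /=; lia. Qed.

Lemma bin2_odd n : 'C((2 * n).+2, 2) = (n.+1 * (2 * n + 1))%N.
Proof. by rewrite bin2 /=; lia. Qed.

(** Induction on [n]: passing to [n.+1], the telescoped sum and the new last summand supply exactly
    the two new triangular exponents, [(n.+1) * (2 * n + 1)] and [(n.+1) * (2 * n + 3)]. *)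
Lemma shanks n :
  odd_qprod n * tri_poly (2 * n).+1 = \sum_(s < n.+1) shanks_term n s.
Proof.
elim: n => [|n IH].
  rewrite /tri_poly !big_ord1 /shanks_term /odd_qprod big_geq // big_ord0.
  by rewrite !mul1r mul0n.
have := @shanks_telescope n n.+1 (leqnn _).
rewrite sumrB -mulr_sumr -IH big_geq // mul1r => /eqP.
rewrite subr_eq => /eqP telescope.
rewrite big_ord_recr /= telescope /shanks_term big_geq // mul1r odd_qprodS.
have -> : tri_poly (2 * n.+1).+1 =
    tri_poly (2 * n).+1 + 'X^(n.+1 * (2 * n + 1)) + 'X^(n.+1 * (2 * n.+1 + 1)).
  rewrite -bin2_even -bin2_odd mulnS !addSn add0n.
  by rewrite /tri_poly 2!big_ord_recr.
by ring.
Qed.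

Lemma qprod1_split n : qprod 1 (2 * n) = odd_qprod n * qprod 2 n.
Proof.
elim: n => [|n IH]; first by rewrite /qprod /odd_qprod !big_geq // big_ord0 mulr1.
have qprodS j N : qprod j N.+1 = qprod j N * (1 - 'X^(j * N.+1)).
  by rewrite /qprod big_nat_recr.
have -> : (2 * n.+1 = (2 * n).+2)%N by lia.
rewrite !qprodS IH odd_qprodS !mul1n addn1 (_ : (2 * n.+1 = (2 * n).+2)%N); last by lia.
move: (2 * n).+1 (2 * n).+2 => c d.
by ring.
Qed.

(** In Shanks's sum every term with [s > 0] is divisible by ['X^(2 * n + 1)], so only [s = 0]
    survives the truncation. *)
Lemma gauss_eqmodX n :
  eqmodX n.+1 (qprod 1 (2 * n) * tri_poly (2 * n).+1) (qprod 2 n * qprod 2 n).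
Proof.
rewrite qprod1_split mulrAC shanks big_ord_recl /=.
have -> : shanks_term n 0 = qprod 2 n.
  by rewrite /shanks_term /odd_qprod /= big_ord0 mul0n expr0 !mulr1.
pose r : {poly int} := \sum_(s < n)
  (\prod_(s.+2 <= k < n.+1) (1 - 'X^(2 * k))) * odd_qprod s.+1 * 'X^(s * (2 * n + 1)).
have -> : \sum_(s < n) shanks_term n s.+1 = r * 'X^(2 * n + 1).
  rewrite mulr_suml; apply: eq_bigr => s _.
  by rewrite /shanks_term mulSn addnC exprD !mulrA.
by rewrite eqmodX_addMXn; [reflexivity | lia].
Qed.

(* Coefficientwise equal to the partition generating function up to degree [N]. *)
Definition part_poly (N : nat) : {poly int} :=
  \prod_(1 <= k < N.+1) \sum_(j < N.+1) 'X^(k * j).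

(** Each truncated geometric sum inverts its factor up to ['X^(k * N.+1)], which vanishes modulo
    ['X^N.+1] since [k > 0]. *)
Lemma qprod1_part_poly N : eqmodX N.+1 (qprod 1 N * part_poly N) 1.
Proof.
rewrite /qprod /part_poly -big_split /= big_nat.
elim/big_rec: _ => // k p /andP[k0 _] IH.
have -> : (1 - 'X^(1 * k)) * (\sum_(j < N.+1) 'X^(k * j))
    = 1 + (-1) * 'X^(k * N.+1) :> {poly int}.
  rewrite mul1n (eq_bigr (fun j : 'I_N.+1 => 'X^k ^+ j)) => [|j _].
    by rewrite mulN1r exprM -opprB mulNr -subrX1 opprB.
  by rewrite exprM.
by rewrite eqmodX_addMXn ?leq_pmull // mul1r.
Qed.

Lemma coef_prod_geom_ge0 m n N i :
  0 <= (\prod_(m <= k < n) \sum_(j < N) 'X^(k * j) : {poly int})`_i.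
Proof.
elim/big_rec: _ i => [i|k p _ IH i]; first by rewrite coef1 ler0n.
rewrite coefM sumr_ge0 // => j _; rewrite mulr_ge0 // coef_sum sumr_ge0 // => l _.
by rewrite coefXn ler0n.
Qed.

Lemma part_poly_gt0 N i : (i <= N)%N -> 0 < (part_poly N)`_i.
Proof.
case: N => [|N] le_iN.
  by move: le_iN; rewrite leqn0 => /eqP ->; rewrite /part_poly big_geq // coef1.
(* Isolate the partition of [i] into parts equal to 1: degree [i] from the factor [k = 1], degree 0
   from all the others. *)
rewrite /part_poly big_ltn // coefM (bigD1 ord_max) //= subnn.
apply: ltr_wpDr.
  apply: sumr_ge0 => j _; apply: mulr_ge0; last exact: coef_prod_geom_ge0.
  by rewrite coef_sum sumr_ge0 // => l _; rewrite coefXn ler0n.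
apply: mulr_gt0.
  rewrite coef_sum (bigD1 (Ordinal (le_iN : i < N.+2)%N)) //= mul1n coefXn eqxx.
  by rewrite ltr_wpDr // sumr_ge0 // => l _; rewrite coefXn ler0n.
rewrite coef0_prod prodr_gt0 // => k _.
rewrite coef_sum big_ord_recl muln0 coefXn ltr_wpDr // sumr_ge0 // => l _.
by rewrite coefXn ler0n.
Qed.

Lemma eqmodX_compXn {R : comNzRingType} N d (p q : {poly R}) : (0 < d)%N ->
  eqmodX N p q -> eqmodX N (p \Po 'X^d) (q \Po 'X^d).
Proof.
move=> d0 pq i iN; rewrite !coef_comp_poly_Xn //; case: ifP => // _.
by rewrite pq // (leq_ltn_trans (leq_div _ _) iN).
Qed.

Lemma qprod_compXn d N : qprod d N = qprod 1 N \Po 'X^d.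
Proof.
rewrite /qprod rmorph_prod /=; apply: eq_bigr => k _.
by rewrite rmorphB /= rmorph1 mul1n rmorphXn /= comp_polyX exprM.
Qed.

Lemma qprod_part_poly d N : (0 < d)%N ->
  eqmodX N.+1 (qprod d N * (part_poly N \Po 'X^d)) 1.
Proof.
move=> d0; rewrite qprod_compXn -rmorphM /= -(rmorph1 (comp_poly 'X^d)).
apply: eqmodX_compXn => //; exact: qprod1_part_poly.
Qed.

Lemma a_eqmodX n :
  eqmodX n.+1 (\poly_(i < n.+1) a_1m1_2p2_5m1 i)
         (tri_poly (2 * n).+1 * (part_poly n \Po 'X^5)).
Proof.
pose I := \poly_(i < n.+1) fps_inv (fps_mul (euler_f 1) (euler_f 5)) i.
have inv15 : eqmodX n.+1 (qprod 1 (2 * n) * qprod 5 n * I) 1.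
  rewrite -!(@euler_f_eqmodX _ n) //; last by lia.
  rewrite -fps_mul_eqmodX -fps_mul_eqmodX => i iN.
  by rewrite coef_poly iN (fps_mulV eta_denominator_unit) coef1.
rewrite /a_1m1_2p2_5m1 /fps_div !fps_mul_eqmodX -/I.
rewrite (@euler_f_eqmodX 2 n n) // -gauss_eqmodX.
(* In place of division, each side is multiplied by a product congruent to 1: the left by [q * v],
   the right by [p * q * I]. The results agree by commutativity. *)
rewrite -[X in eqmodX _ X _]mulr1 -{1}(@qprod_part_poly 5 n) //.
rewrite -[X in eqmodX _ _ X]mulr1 -inv15.
set p := qprod 1 _; set q := qprod 5 _; set t := tri_poly _; set v := _ \Po _.
by rewrite (_ : p * t * I * (q * v) = t * v * (p * q * I)); last ring.
Qed.

Lemma triangular_mod5 s : ('C(s.+1, 2) %% 5)%N \in [:: 0; 1; 3]%N.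
Proof.
have : (2 * 'C(s.+1, 2) = s.+1 * s)%N by rewrite -mul_bin_diag bin1.
move: ('C(s.+1, 2)) => b eq_b.
have : (2 * (b %% 5) = (s %% 5 + 1) * (s %% 5) %[mod 5])%N.
  by rewrite !modnMmr -[RHS]modnMml modnDml modnMml addn1 eq_b.
have := ltn_pmod s (isT : 0 < 5)%N; have := ltn_pmod b (isT : 0 < 5)%N.
case: (b %% 5)%N => [|[|[|[|[|]]]]] // _;
by case: (s %% 5)%N => [|[|[|[|[|]]]]].
Qed.

(** The test ['C(s.+1, 2) <= n] matters: otherwise the truncated difference would be 0, hence
    divisible by 5. *)
Lemma a_coef n :
  a_1m1_2p2_5m1 n = \sum_(s < (2 * n).+1)
    if ('C(s.+1, 2) <= n)%N && (5 %| n - 'C(s.+1, 2))%N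
    then (part_poly n)`_((n - 'C(s.+1, 2)) %/ 5) else 0.
Proof.
have := @a_eqmodX n n (leqnn _); rewrite coef_poly leqnn => ->.
rewrite /tri_poly mulr_suml coef_sum; apply: eq_bigr => s _.
rewrite coefXnM coef_comp_poly_Xn //.
by case: leqP.
Qed.

Lemma a_eq0 n : (n %% 5)%N \in [:: 2; 4]%N -> a_1m1_2p2_5m1 n = 0.
Proof.
move=> n_mod; rewrite a_coef big1 // => s _; case: ifP => // /andP[le_sn dvd_ns].
have := triangular_mod5 s.
have : 'C(s.+1, 2) = n %[mod 5] by apply/eqP; rewrite eq_sym eqn_mod_dvd.
by move=> ->; move: n_mod; rewrite !inE => /orP[] /eqP ->.
Qed.

Lemma a_gt0 n s : ('C(s.+1, 2) <= n)%N -> n = 'C(s.+1, 2) %[mod 5] ->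
  0 < a_1m1_2p2_5m1 n.
Proof.
move=> le_sn eq_ns; rewrite a_coef.
(* The index lies in the summation range because [s <= 'C(s.+1, 2) <= n]. *)
have lt_s : (s < (2 * n).+1)%N.
  by move: le_sn; rewrite bin2 /=; case: s {eq_ns} => [|s] /=; nia.
rewrite (bigD1 (Ordinal lt_s)) //= le_sn -eqn_mod_dvd // eq_ns eqxx /=.
apply: ltr_wpDr.
  apply: sumr_ge0 => j _; case: ifP => // _; exact: coef_prod_geom_ge0.
by apply: part_poly_gt0; rewrite (leq_trans (leq_div _ _)) // leq_subr.
Qed.

Theorem theorem5p1 (n : nat) :
  0 < a_1m1_2p2_5m1 (5 * n)%N /\
  0 < a_1m1_2p2_5m1 (5 * n + 1)%N /\
  a_1m1_2p2_5m1 (5 * n + 2)%N = 0 /\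
  0 < a_1m1_2p2_5m1 (5 * n + 3)%N /\
  a_1m1_2p2_5m1 (5 * n + 4)%N = 0.
Proof.
(* The witnesses [s = 0, 1, 2] give the triangular numbers 0, 1, 3. *)
split; first by apply: (@a_gt0 _ 0) => //; rewrite mulnC modnMl.
split; first by apply: (@a_gt0 _ 1); [rewrite leq_addl | rewrite mulnC modnMDl].
split; first by apply: a_eq0; rewrite mulnC modnMDl.
split; first by apply: (@a_gt0 _ 2); [rewrite leq_addl | rewrite mulnC modnMDl].
by apply: a_eq0; rewrite mulnC modnMDl.
Qed.
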